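(* Let $K$ be a field and let $R=K[x_1,\ldots,x_r]/I_\Delta$ be the $d$-dimensional face ring of a simplicial complex $\Delta$ on $r$ vertices. Let $J=(x_1^{v_1},\ldots,x_r^{v_r})R$, where $v_i>0$ are integers for all $i$. Then the generalized Hilbert-Kunz function $\ell\left(R/(J^{[q]})^k\right)$ is a polynomial for all $q,k$; that is, there is a polynomial $P\in\mathbb{Q}[X,Y]$ such that $\ell\left(R/(J^{[q]})^k\right)=P(q,k)$ for all positive integers $q,k$.
   Context: There is no restriction on the characteristic of $K$. The face ring (Stanley-Reisner ring) of a simplicial complex $\Delta$ on vertices $x_1,\dots,x_r$ is $K[x_1,\ldots,x_r]/I_\Delta$, where $I_\Delta$ is the ideal generated by the squarefree monomials $\prod_{i\in F}x_i$ with $F\notin\Delta$; equivalently $I_\Delta=\bigcap_{F}(x_i\mid i\notin F)$ over the facets $F$ of $\Delta$. For a positive integer $q$, $J^{[q]}=(x_1^{qv_1},\ldots,x_r^{qv_r})R$, and $\ell$ denotes length. *)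

(* Defs.v *)
From HB Require Import structures.
From mathcomp Require Import all_boot all_order all_algebra.
From mathcomp Require Import generic_quotient ring_quotient boolp mpoly.

Set Implicit Arguments.
Unset Strict Implicit.
Unset Printing Implicit Defensive.

Import GRing.Theory.

Local Open Scope ring_scope.
Local Open Scope quotient_scope.

Section Chains.
Variable T : Type.

Definition strict_sub (U V : {pred T}) : Prop :=
  {subset U <= V} /\ exists2 x, x \in V & x \notin U.

(* A chain of length n has n + 1 terms U 0, ..., U n; the values of U beyond
   n are ignored. *)
Definition has_chain (C : {pred T} -> Prop) (n : nat) : Prop :=
  exists U : nat -> {pred T},
    (forall i, (i <= n)%N -> C (U i)) /\
    (forall i, (i < n)%N -> strict_sub (U i) (U i.+1)).

Definition max_chain (C : {pred T} -> Prop) (n : nat) : Prop :=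
  has_chain C n /\ forall m, has_chain C m -> (m <= n)%N.

End Chains.

(* The module M has finite length, equal to n. *)
Definition has_length (R : nzRingType) (M : lmodType R) (n : nat) : Prop :=
  max_chain (fun U : {pred M} => submod_closed U) n.

(* [idealr_closed] includes 1 \notin P. *)
Definition prime_ideal (R : comNzRingType) (P : {pred R}) : Prop :=
  idealr_closed P /\ prime_idealr_closed P.

Definition krull_dim (R : comNzRingType) (d : nat) : Prop :=
  max_chain (@prime_ideal R) d.

Section QuotientModule.
Variables (R : nzRingType) (M : lmodType R) (N : submodClosed M).

(* [submodClosed] does not inherit from [zmodClosed], which [Quotient.quot]
   needs. *)
Definition quot_pred : {pred M} := N.
HB.instance Definition _ := GRing.isZmodClosed.Build M quot_pred
  (GRing.submod_closedB (submodClosedP N)).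

Definition quotmod := Quotient.quot quot_pred.
HB.instance Definition _ := GRing.Zmodule.on quotmod.
HB.instance Definition _ := EqQuotient.on quotmod.

Definition qscale (a : R) : quotmod -> quotmod :=
  lift_op1 quotmod (fun x : M => a *: x).

Lemma pi_qscale a (x : M) : \pi_quotmod (a *: x) = qscale a (\pi_quotmod x).
Proof.
unlock qscale; apply/eqP; rewrite -Quotient.idealrBE -scalerBr.
by apply: (@rpredZ _ _ N); rewrite -[_ \in _]/(_ \in quot_pred) Quotient.idealrBE reprK.
Qed.

Lemma pi_quotmodD (x y : M) :
  \pi_quotmod (x + y) = \pi_quotmod x + \pi_quotmod y.
Proof. exact: (Quotient.pi_add quot_pred). Qed.

Lemma qscaleA a b v : qscale a (qscale b v) = qscale (a * b) v.
Proof. by rewrite -[v]reprK -!pi_qscale scalerA. Qed.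

Lemma qscale1 : left_id 1 qscale.
Proof. by move=> v; rewrite -[v]reprK -pi_qscale scale1r. Qed.

Lemma qscaleDr : right_distributive qscale +%R.
Proof.
move=> a u v; rewrite -[u]reprK -[v]reprK -pi_quotmodD -!pi_qscale scalerDr.
exact: pi_quotmodD.
Qed.

Lemma qscaleDl v : {morph qscale^~ v : a b / a + b}.
Proof.
by move=> a b; rewrite -[v]reprK -!pi_qscale scalerDl pi_quotmodD.
Qed.

HB.instance Definition _ := GRing.Zmodule_isLmodule.Build R quotmod
  qscaleA qscale1 qscaleDr qscaleDl.

End QuotientModule.

Section Ideals.
Variable R : comNzRingType.

Definition gen_ideal (G : R -> Prop) : {pred R^o} := fun x =>
  `[< exists n (c g : 'I_n -> R),
        (forall i, G (g i)) /\ x = \sum_(i < n) c i * g i >].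

Lemma gen_ideal_submod G : submod_closed (gen_ideal G).
Proof.
split=> [|a x y].
  by apply/asboolP; exists 0%N, (fun=> 0), (fun=> 0); split=> [[]|]; rewrite ?big_ord0.
move=> /asboolP[n [c [g [Gg ->]]]] /asboolP[m [c' [g' [Gg' ->]]]].
apply/asboolP; exists (n + m)%N.
exists (fun i => match split i with inl j => a * c j | inr j => c' j end).
exists (fun i => match split i with inl j => g j | inr j => g' j end).
split=> [i|]; first by case: (split i).
rewrite big_split_ord /= scaler_sumr; congr (_ + _); apply: eq_bigr => i _.
  by rewrite (unsplitK (inl i : 'I_n + 'I_m)) scalerAl.
by rewrite (unsplitK (inr i : 'I_n + 'I_m)).
Qed.

HB.instance Definition _ (G : R -> Prop) :=
  GRing.isSubmodClosed.Build R R^o (gen_ideal G) (gen_ideal_submod G).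

Definition ideal_exp (I : {pred R}) (k : nat) : {pred R^o} :=
  gen_ideal (fun y => exists x : 'I_k -> R,
    (forall i, x i \in I) /\ y = \prod_(i < k) x i).

HB.instance Definition _ (I : {pred R}) (k : nat) :=
  GRing.SubmodClosed.on (ideal_exp I k).

End Ideals.

(* Not every singleton is required to be a face. *)
Record simplicial_complex (r : nat) := SimplicialComplex {
  faces :> {set {set 'I_r}};
  face0 : set0 \in faces;
  face_sub : forall F G : {set 'I_r}, G \subset F -> F \in faces -> G \in faces
}.

Section FaceRing.
Variables (K : fieldType) (r : nat) (D : simplicial_complex r).

Definition sr_ideal : {pred {mpoly K[r]}} :=
  gen_ideal (fun f : {mpoly K[r]} =>
    exists2 F : {set 'I_r}, F \notin faces D & f = \prod_(i in F) 'X_i).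

Lemma sr_ideal_closed : idealr_closed sr_ideal.
Proof.
have [I0 Ic] := @gen_ideal_submod {mpoly K[r]} (fun f =>
  exists2 F : {set 'I_r}, F \notin faces D & f = \prod_(i in F) 'X_i).
split=> //; apply/negP => /asboolP[n [c [g [Gg]]]].
move=> /(congr1 (meval (fun=> 0))); rewrite meval1 rmorph_sum /= big1 => [/eqP|i _].
  by rewrite oner_eq0.
have [F F_D ->] := Gg i; rewrite mevalM rmorph_prod /=.
case: (set_0Vmem F) F_D => [->|[j jF] _]; first by rewrite face0.
by rewrite (bigD1 j) //= mevalXU mul0r mulr0.
Qed.

HB.instance Definition _ := isIdealr.Build _ sr_ideal sr_ideal_closed.

Definition face_ring : comNzRingType := {ideal_quot sr_ideal}.

Definition face_var (i : 'I_r) : face_ring := \pi_{ideal_quot sr_ideal} 'X_i.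

(* J^[q] for J = (x_1^(v_1), ..., x_r^(v_r)) *)
Definition bracket_power (v : 'I_r -> nat) (q : nat) : {pred face_ring} :=
  gen_ideal (fun y : face_ring => exists i, y = face_var i ^+ (q * v i)).

End FaceRing.

Arguments bracket_power K {r} D v q.

(* Main.v *)
Require Import Defs.
From mathcomp Require Import all_boot all_order all_algebra mpoly.
From mathcomp Require Import generic_quotient ring_quotient boolp.
Set Implicit Arguments.
Unset Strict Implicit.
Unset Printing Implicit Defensive.
Import GRing.Theory Num.Theory.
Local Open Scope ring_scope.

(** Everything is monomial.  Write [Q_i = q v_i].  In the face ring the
monomial [x^a] is nonzero exactly when its support is a face, and a nonzero
[x^a] lies in the [k]-th power of [(x_1^Q_1, ..., x_r^Q_r)] exactly when one
can split off [k] of the generators, that is when [sum_i floor (a_i / Q_i)] is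
at least [k].  So the quotient has as [K]-basis the finitely many standard
monomials: those supported on a face and with [sum_i floor (a_i / Q_i) < k].

The length equals the number of these monomials
([has_length_standard]).  Strict chains of submodules are strict chains of
[K]-subspaces, which bounds their length; conversely, listing the standard
monomials by decreasing degree, each initial segment spans a submodule,
because multiplication only raises degrees ([has_length_triangular]).

It remains to count.  The standard monomials supported inside a set [F] of
variables are determined by the quotients [floor (a_i / Q_i)], which form a
lattice point of a simplex, and by the remainders, so there are
[(prod_(i in F) Q_i) * binomial (#|F| + k - 1, #|F|)] of them
([sum_count_on]), a polynomial in [q] and [k].  Hence so is, by induction on
[F], the number of those whose support is exactly [F]
([poly_function_count_on]), and the length is the sum of these numbers over
the faces [F]. *)

(** * Length of a module with a triangular basis *)

Section Length.
Variables (A : nzRingType) (K : fieldType) (M : lmodType A) (n : nat).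
Variables (phi : M -> 'rV[K]_n) (iota : K -> A).
Hypothesis phiD : {morph phi : x y / x + y}.
Hypothesis phi_iota : forall c x, phi (iota c *: x) = c *: phi x.
Hypothesis phi_inj : injective phi.

Let phi0 : phi 0 = 0.
Proof. by apply: (addrI (phi 0)); rewrite -phiD !addr0. Qed.

(** The coordinates of elements chosen in the successive differences of a
strict chain are linearly independent: in a nontrivial linear relation, the
element with the largest index would lie in the submodule it was chosen
outside of. *)
Lemma chain_length_le m :
  has_chain (fun U : {pred M} => submod_closed U) m -> (m <= n)%N.
Proof.
case=> U [Umod Ustrict].
have U_mono i j : (i <= j)%N -> (j <= m)%N -> {subset U i <= U j}.
  elim: j => [|j IH]; first by rewrite leqn0 => /eqP-> _ x.
  rewrite leq_eqVlt => /orP[/eqP-> _ x // |le_ij] lt_jm x Ux.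
  by have [sub _] := Ustrict j lt_jm; apply/sub/IH => //; apply: ltnW.
have pick_new (i : 'I_m) : exists x, x \in U i.+1 /\ x \notin U i.
  by have [_ [x]] := Ustrict i (ltn_ord i); exists x.
have [x xP] := choice pick_new.
pose B : 'M[K]_(m, n) := \matrix_(i < m) phi (x i).
rewrite -(_ : \rank B = m) ?rank_leq_col //.
apply/eqP; rewrite -[_ == _]/(row_free B) -kermx_eq0.
apply/rowV0P => u /sub_kermxP uB0.
apply: contrapT => /eqP u_neq0.
have [j0 uj0] : exists j, u 0 j != 0.
  apply: contrapT => no; apply/(elimN eqP u_neq0)/rowP => j; rewrite mxE.
  by apply: contrapT => /eqP uj; apply: no; exists j.
case: (@arg_maxnP _ j0 (fun j => u 0 j != 0) (fun j => j : nat) uj0) =>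
  j uj jmax.
have [xj_in xj_notin] := xP j.
have [U0 Uc] := Umod j (ltnW (ltn_ord j)).
have phi_sum : phi (\sum_(i < m) iota (u 0 i) *: x i) = 0.
  rewrite (big_morph phi phiD phi0) -[RHS]uB0 mulmx_sum_row.
  by apply: eq_bigr => i _; rewrite phi_iota rowK.
have sum0 : \sum_(i < m) iota (u 0 i) *: x i = 0.
  by apply: phi_inj; rewrite phi_sum phi0.
(* [j] is the largest index with a nonzero coefficient, so only elements of
   [U j] contribute. *)
have U_sum : - \sum_(i < m | i != j) iota (u 0 i) *: x i \in U j.
  rewrite -scaleN1r -[_ *: _]addr0; apply: (Uc) => //.
  apply: (big_ind (fun y => y \in U j)) => // [y z Uy Uz|i ij].
    by rewrite -[y]scale1r; apply: Uc.
  have [lt_ij|le_ji] := ltnP i j.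
    rewrite -[_ *: _]addr0; apply: Uc => //.
    apply: (U_mono i.+1 j) => //; last by case: (xP i).
    by apply: ltnW.
  suff ->: u 0 i = 0.
    suff ->: iota 0 *: x i = 0 by [].
    by apply: phi_inj; rewrite phi_iota scale0r phi0.
  apply: contrapT => /eqP/jmax /= le_ij.
  by move/eqP: ij; apply; apply/val_inj/anti_leq; rewrite le_ij.
case/negP: xj_notin.
have -> : x j = iota (u 0 j)^-1 *: (iota (u 0 j) *: x j) + 0.
  by apply: phi_inj; rewrite addr0 !phi_iota scalerA mulVf // scale1r.
apply: Uc => //; move: sum0; rewrite (bigD1 j) //= => /eqP.
by rewrite addr_eq0 => /eqP->.
Qed.

Hypothesis phi_surj : forall w, exists x, phi x = w.
Hypothesis phi_triangular : forall a x (i : 'I_n),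
  (forall j : 'I_n, (i <= j)%N -> phi x 0 j = 0) -> phi (a *: x) 0 i = 0.

(** Triangularity says that the elements with zero coordinates from the
[i]-th one on form an [A]-submodule, and not merely a [K]-subspace; these
submodules, one for each [i], make up a chain of the maximal length. *)
Lemma has_length_triangular : has_length M n.
Proof.
split; last exact: chain_length_le.
exists (fun i (x : M) => [forall j : 'I_n, (i <= j)%N ==> (phi x 0 j == 0)]).
split=> [i le_in|i lt_in].
  split=> [|a x y]; first by apply/forallP => j; rewrite phi0 mxE eqxx implybT.
  move=> /forallP/(_ _)/implyP Ux /forallP/(_ _)/implyP Uy.
  apply/forallP => j; apply/implyP => le_ij; rewrite phiD mxE.
  rewrite (eqP (Uy j le_ij)) addr0 phi_triangular // => l le_jl.
  by apply/eqP/Ux/(leq_trans le_ij).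
split=> [x /forallP/(_ _)/implyP Ux|].
  by apply/forallP => j; apply/implyP => /ltnW/Ux.
have [x phix] := phi_surj (delta_mx 0 (Ordinal lt_in)).
exists x.
  apply/forallP => j; apply/implyP => lt_ij; rewrite phix mxE eqxx /=.
  by rewrite [j == _]gtn_eqF ?mulr0n.
apply/negP => /forallP/(_ (Ordinal lt_in)); rewrite leqnn phix mxE !eqxx.
by rewrite oner_eq0.
Qed.

End Length.

(** * Standard monomials of the face ring *)

Definition exp_support r (m : 'X_{1..r}) : {set 'I_r} := [set i | m i != 0%N].

(** For positive [Q], the largest number of factors, each some [x_i ^ (Q i)],
that can be split off the monomial. *)
Definition floor_weight r (Q : 'I_r -> nat) (m : 'X_{1..r}) : nat :=
  \sum_i (m i %/ Q i)%N.

Definition standard r (D : simplicial_complex r) (Q : 'I_r -> nat) k m :=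
  (exp_support m \in faces D) && (floor_weight Q m < k)%N.

Lemma mcoeffM_eq0 r (K : nzRingType) (p1 p2 : {mpoly K[r]}) (m : 'X_{1..r}) :
  (forall m1 m2, m = (m1 + m2)%MM -> p1@_m1 * p2@_m2 = 0) -> (p1 * p2)@_m = 0.
Proof. by move=> all0; rewrite mcoeffM big1 // => -[m1 m2] /eqP/all0. Qed.

Lemma mem_gen_ideal (R : comNzRingType) (G : R -> Prop) y :
  G y -> y \in gen_ideal G.
Proof.
move=> Gy; apply/asboolP; exists 1%N, (fun=> 1), (fun=> y); split=> //.
by rewrite big_ord1 mul1r.
Qed.

Lemma gen_ideal_mull (R : comNzRingType) (G : R -> Prop) a y :
  y \in gen_ideal G -> a * y \in gen_ideal G.
Proof.
by move=> Gy; have [G0 Gc] := gen_ideal_submod G; rewrite -[_ * _]addr0;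
  apply: Gc.
Qed.

Lemma ideal_expS (R : comNzRingType) (I : {pred R}) k x y :
  x \in I -> y \in ideal_exp I k -> x * y \in ideal_exp I k.+1.
Proof.
move=> Ix /asboolP[n [c [g [Gg ->]]]]; apply/asboolP.
exists n, c, (fun i => x * g i); split=> [i|]; last first.
  by rewrite mulr_sumr; apply: eq_bigr => i _; rewrite mulrCA.
have [h [Ih ->]] := Gg i.
exists (fun j => if unlift ord0 j is Some j' then h j' else x); split=> [j|].
  by case: unliftP.
by rewrite big_ord_recl unlift_none; congr (_ * _); apply: eq_bigr => j _;
  rewrite liftK.
Qed.

Section FaceRingQuotient.
Variables (K : fieldType) (r : nat) (D : simplicial_complex r).
Variable (Q : 'I_r -> nat).

Implicit Types (p : {mpoly K[r]}) (m : 'X_{1..r}).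

(** For positive [Q], these are the polynomials whose class in the face ring
lies in the [k]-th power of the ideal generated by the [x_i ^ (Q i)]:
see [mem_ideal_exp]. *)
Definition vanishing k p := forall m, standard D Q k m -> p@_m = 0.

Lemma vanishingD k p1 p2 :
  vanishing k p1 -> vanishing k p2 -> vanishing k (p1 + p2).
Proof. by move=> v1 v2 m std; rewrite mcoeffD v1 // v2 // addr0. Qed.

Lemma vanishing_sum k (I : Type) (s : seq I) (F : I -> {mpoly K[r]}) :
  (forall i, vanishing k (F i)) -> vanishing k (\sum_(i <- s) F i).
Proof.
move=> Fv; apply: (big_ind (vanishing k)) => // [m _|]; first exact: mcoeff0.
exact: vanishingD.
Qed.

Lemma floor_weightD m1 m2 :
  (floor_weight Q m1 + floor_weight Q m2 <= floor_weight Q (m1 + m2))%N.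
Proof.
rewrite -big_split; apply: leq_sum => i _; rewrite mnmDE.
by case: (posnP (Q i)) => [->|Q_gt0]; rewrite ?divn0 // divnD // leq_addr.
Qed.

(** If [m1 * m2] is standard for [s + t], then both factors are supported on
faces and, by superadditivity of the floor weight, [m1] is standard for [s] or
[m2] is standard for [t]. *)
Lemma vanishingM s t p1 p2 :
  vanishing s p1 -> vanishing t p2 -> vanishing (s + t) (p1 * p2).
Proof.
move=> v1 v2 m /andP[mD mw]; apply: mcoeffM_eq0 => m1 m2 def_m.
have face1 m' : (forall i, m' i <= m i)%N -> exp_support m' \in faces D.
  move=> le_m; apply: face_sub mD; apply/subsetP => i; rewrite !inE.
  by rewrite -!lt0n => /leq_trans; apply.
have [lt_s|le_s] := ltnP (floor_weight Q m1) s.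
  rewrite v1 ?mul0r // /standard lt_s face1 // => i.
  by rewrite def_m mnmDE leq_addr.
rewrite v2 ?mulr0 // /standard face1 /= => [|i]; last first.
  by rewrite def_m mnmDE leq_addl.
rewrite -(ltn_add2l s); apply: leq_ltn_trans mw; rewrite def_m.
by apply: leq_trans (floor_weightD _ _); rewrite leq_add2r.
Qed.

Lemma vanishingMl t p1 p2 : vanishing t p2 -> vanishing t (p1 * p2).
(* No monomial has weight below 0, so every polynomial is [vanishing 0]. *)
Proof. by apply: (@vanishingM 0%N) => m; rewrite /standard ltn0 andbF. Qed.

Lemma prod_var_monomial (F : {set 'I_r}) :
  \prod_(i in F) 'X_i = 'X_[[multinom (i \in F : nat) | i < r]] :> {mpoly K[r]}.
Proof.
rewrite [RHS]mpolyXE_id big_mkcond; apply: eq_bigr => i _.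
by rewrite mnmE; case: (i \in F).
Qed.

Lemma vanishing_sr_ideal t p : p \in sr_ideal D -> vanishing t p.
Proof.
move=> /asboolP[n [c [g [Gg ->]]]]; apply: vanishing_sum => i;
  apply: vanishingMl.
have [F FnD ->] := Gg i; rewrite prod_var_monomial => m /andP[mD _].
rewrite mcoeffX; case: eqP => // def_m; case/negP: FnD.
rewrite (_ : F = exp_support m) //; apply/setP => j.
by rewrite inE -def_m mnmE; case: (j \in F).
Qed.

Definition face_proj p : face_ring K D := \pi_({ideal_quot (sr_ideal D)})%qT p.

Lemma face_projD : {morph face_proj : p1 p2 / p1 + p2}.
Proof. exact: Quotient.pi_add. Qed.

Lemma face_projM : {morph face_proj : p1 p2 / p1 * p2}.
Proof. exact: (Quotient.pi_mul (sr_ideal D)). Qed.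

Lemma face_proj0 : face_proj 0 = 0.
Proof. by apply: (addrI (face_proj 0)); rewrite -face_projD !addr0. Qed.

Lemma face_proj_surj y : exists p, face_proj p = y.
Proof. by exists (repr (y : {ideal_quot (sr_ideal D)})); apply: reprK. Qed.

Lemma face_proj1 : face_proj 1 = 1.
Proof.
have [p p1] := face_proj_surj 1.
by rewrite -[LHS]mulr1 -[in LHS]p1 -face_projM mul1r.
Qed.

Lemma face_projB : {morph face_proj : p1 p2 / p1 - p2}.
Proof. by move=> p1 p2; apply: (addIr (face_proj p2));
  rewrite -face_projD !subrK. Qed.

Lemma face_projX p n : face_proj (p ^+ n) = face_proj p ^+ n.
Proof. by elim: n => [|n IH]; rewrite ?face_proj1 // !exprS face_projM IH. Qed.

Lemma face_proj_eq p1 p2 :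
  (face_proj p1 = face_proj p2) <-> (p1 - p2 \in sr_ideal D).
Proof. by rewrite (Quotient.idealrBE (sr_ideal D)); split=> [/eqP|/eqP]. Qed.

Lemma face_proj_nonface m :
  exp_support m \notin faces D -> face_proj 'X_[m] = 0.
Proof.
move=> mnD; rewrite -face_proj0 face_proj_eq subr0.
have ->: 'X_[m] = 'X_[[multinom (m i).-1 | i < r]]
                * \prod_(i in exp_support m) 'X_i :> {mpoly K[r]}.
  rewrite prod_var_monomial -mpolyXD; congr 'X_[_]; apply/mnmP => i.
  by rewrite mnmDE !mnmE inE; case: (m i) => //= n; rewrite addn1.
by apply: gen_ideal_mull; apply: mem_gen_ideal; exists (exp_support m).
Qed.

(** Membership in an ideal of the face ring can be tested on any lift, since
the Stanley-Reisner ideal consists of vanishing polynomials. *)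
Lemma vanishing_gen_ideal t (G : face_ring K D -> Prop) p :
    (forall y, G y -> exists2 p', face_proj p' = y & vanishing t p') ->
  face_proj p \in gen_ideal G -> vanishing t p.
Proof.
move=> Gv /asboolP[n [c [g [Gg def_p]]]].
have /choice[a ca] i := face_proj_surj (c i).
have /choice[b bP] i : exists p', face_proj p' = g i /\ vanishing t p'.
  by have [p'] := Gv _ (Gg i); exists p'.
rewrite -[p](subrK (\sum_i a i * b i)); apply: vanishingD.
  apply: vanishing_sr_ideal; apply/face_proj_eq; rewrite def_p.
  rewrite (big_morph face_proj face_projD face_proj0); apply: eq_bigr => i _.
  by rewrite face_projM ca; case: (bP i) => ->.
by apply: vanishing_sum => i; apply: vanishingMl; case: (bP i).
Qed.

Variables (v : 'I_r -> nat) (q : nat).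
Hypothesis Q_gt0 : forall i, (0 < Q i)%N.
Hypothesis Q_def : forall i, Q i = (q * v i)%N.

Lemma vanishing_bracket_power p :
  face_proj p \in bracket_power K D v q -> vanishing 1 p.
Proof.
apply: vanishing_gen_ideal => _ [i ->]; exists ('X_i ^+ Q i).
  by rewrite face_projX Q_def.
move=> m /andP[_]; rewrite ltnS leqn0 sum_nat_eq0 => /forallP/(_ i)/=.
rewrite mcoeffXn => wi; case: eqP => // def_m; move: wi.
by rewrite -def_m mulmnE mnm1E eqxx mul1n divnn Q_gt0.
Qed.

Lemma vanishing_ideal_exp k p :
  face_proj p \in ideal_exp (bracket_power K D v q) k -> vanishing k p.
Proof.
apply: vanishing_gen_ideal => _ [x [Ix ->]].
have /choice[a ax] i := face_proj_surj (x i).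
exists (\prod_i a i).
  by rewrite (big_morph face_proj face_projM face_proj1); apply: eq_bigr.
have {Ix} va i : vanishing 1 (a i) by apply: vanishing_bracket_power;
  rewrite ax.
clear ax; elim: k a va {x} => [|k IH] a va.
  by move=> m; rewrite /standard ltn0 andbF.
rewrite big_ord_recl; apply: (@vanishingM 1%N) => //.
by apply: IH => i; apply: va.
Qed.

(** A monomial of positive weight is divisible by some [x_i ^ (Q i)], and the
weight of the cofactor is smaller by exactly 1. *)
Lemma monomial_ideal_exp k m :
  (k <= floor_weight Q m)%N ->
  face_proj 'X_[m] \in ideal_exp (bracket_power K D v q) k.
Proof.
elim: k m => [|k IH] m le_k.
  rewrite -[face_proj _]mulr1; apply: gen_ideal_mull; apply: mem_gen_ideal.
  by exists (fun=> 1); split=> [[]|] //; rewrite big_ord0.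
have : floor_weight Q m != 0%N by rewrite -lt0n; apply: leq_ltn_trans le_k.
rewrite sum_nat_eq0 => /forallPn[i] /=; rewrite -lt0n divn_gt0 // => le_Qm.
have def_m : m = (U_(i) *+ Q i + (m - U_(i) *+ Q i))%MM.
  rewrite addmC submK //; apply/mnm_lepP => j; rewrite mulmnE mnm1E.
  by case: eqP => [<-|]; rewrite ?mul1n ?mul0n.
rewrite def_m mpolyXD face_projM; apply: ideal_expS.
  by apply: mem_gen_ideal; exists i; rewrite -mpolyXn face_projX Q_def.
apply: IH; rewrite -ltnS; apply: leq_trans le_k _.
rewrite /floor_weight (bigD1 i) //= [in X in (_ <= X)%N](bigD1 i) //=.
rewrite mnmBE mulmnE mnm1E eqxx mul1n -addSn; apply: leq_add.
  by rewrite -{1}(subnK le_Qm) divnDr // divnn Q_gt0 addn1.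
by apply: leq_sum => j ji; rewrite mnmBE mulmnE mnm1E eq_sym (negPf ji) subn0.
Qed.

Lemma mem_ideal_exp k p :
  (face_proj p \in ideal_exp (bracket_power K D v q) k) <-> vanishing k p.
Proof.
split=> [|vp]; first exact: vanishing_ideal_exp.
have [I0 Ic] := gen_ideal_submod (fun y => exists x : 'I_k -> face_ring K D,
  (forall i, x i \in bracket_power K D v q) /\ y = \prod_(i < k) x i).
rewrite [p]mpolyE (big_morph face_proj face_projD face_proj0).
rewrite big_seq; apply: (big_ind (fun y => y \in ideal_exp _ k)) =>
  // [x y Ix Iy|m].
  by rewrite -[x]mul1r; apply: Ic.
rewrite mcoeff_msupp => pm; rewrite -mul_mpolyC face_projM;
  apply: gen_ideal_mull.
have [mD|mD] := boolP (exp_support m \in faces D);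
  last by rewrite face_proj_nonface.
apply: monomial_ideal_exp; rewrite leqNgt; apply: contra pm => lt_k.
by rewrite vp // /standard mD.
Qed.

Section Quotient.
Variables (k : nat) (s : seq 'X_{1..r}).
Hypothesis s_uniq : uniq s.
Hypothesis mem_s : forall m, (m \in s) = standard D Q k m.

(* Decreasing degree makes multiplication triangular on coordinates. *)
Let s' := sort (relpre mdeg geq) s.
Let M := quotmod (ideal_exp (bracket_power K D v q) k).

Lemma has_length_standard : has_length M (size s).
Proof.
have mem_s' m : (m \in s') = standard D Q k m by rewrite mem_sort mem_s.
have s'_uniq : uniq s' by rewrite sort_uniq.
have size_s' : size s' = size s by rewrite size_sort.
have s'_sorted : sorted (relpre mdeg geq) s'.
  by apply: sort_sorted => m1 m2; apply: leq_total.
pose E i := nth 0%MM s' i.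
pose cls p : M := (\pi_M (face_proj p))%qT.
have clsD : {morph cls : p1 p2 / p1 + p2}.
  by move=> p1 p2; rewrite /cls face_projD pi_quotmodD.
have clsM a p : face_proj a *: cls p = cls (a * p).
  by rewrite /cls face_projM; apply/esym/pi_qscale.
have cls_eq p1 p2 : cls p1 = cls p2 <-> vanishing k (p1 - p2).
  rewrite -mem_ideal_exp face_projB /cls.
  have := Quotient.idealrBE (quot_pred (ideal_exp (bracket_power K D v q) k))
    (face_proj p1) (face_proj p2).
  by rewrite -[(_ - _ \in _)]/(face_proj p1 - face_proj p2 \in ideal_exp _ k)
    => ->; split=> /eqP.
have /choice[rep repK] (x : M) : exists p, cls p = x.
  by have [p pE] := face_proj_surj (repr x); exists p; rewrite /cls pE reprK.
(* The coordinates of [x] are the coefficients at the standard monomials of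
   any representative. *)
pose phi x : 'rV[K]_(size s) := \row_i (rep x)@_(E i).
have stdE (i : 'I_(size s)) : standard D Q k (E i).
  by rewrite -mem_s' mem_nth // size_s'.
have phiE p i : phi (cls p) 0 i = p@_(E i).
  have /cls_eq/(_ _ (stdE i)) := repK (cls p).
  by rewrite mcoeffB mxE => /eqP; rewrite subr_eq0 => /eqP.
have nth_E m : standard D Q k m -> exists i : 'I_(size s), m = E i.
  rewrite -mem_s' => ms; have := ms; rewrite -index_mem size_s' => lt_i.
  by exists (Ordinal lt_i); rewrite /E nth_index.
apply: (@has_length_triangular _ K M (size s) phi (fun c => face_proj c%:MP)).
- move=> x y; rewrite -[x]repK -[y]repK -clsD.
  by apply/rowP => i; rewrite [RHS]mxE !phiE mcoeffD.
- move=> c x; rewrite -[x]repK clsM.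
  by apply/rowP => i; rewrite [RHS]mxE !phiE mcoeffCM.
- move=> x y; rewrite -[x]repK -[y]repK => /rowP phi_eq.
  apply/cls_eq => m /nth_E[i ->].
  by have := phi_eq i; rewrite !phiE mcoeffB => ->; rewrite subrr.
- move=> w; exists (cls (\sum_i w 0 i *: 'X_[E i])); apply/rowP => i.
  rewrite phiE linear_sum (bigD1 i) //= mcoeffZ mcoeffX eqxx mulr1 big1 ?addr0
    // => j ji.
  rewrite mcoeffZ mcoeffX nth_uniq ?size_s' // -[(j == i :> nat)]/(j == i).
  by rewrite (negPf ji) mulr0.
move=> y x i; have [a <-] := face_proj_surj y; rewrite -[x]repK clsM phiE => x0.
apply: mcoeffM_eq0 => m1 m2 def_m.
have /nth_E[j def_m2] : standard D Q k m2.
  have /andP[iD iw] := stdE i; apply/andP; split.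
    apply: face_sub iD; apply/subsetP => l; rewrite !inE def_m mnmDE addn_eq0.
    by rewrite negb_and orbC => ->.
  by apply: leq_ltn_trans iw; rewrite def_m;
    apply: leq_trans (floor_weightD _ _); apply: leq_addl.
(* A proper divisor of [E i] has smaller degree, hence comes after it. *)
rewrite def_m2 -phiE x0 ?mulr0 // leqNgt; apply/negP => lt_ji.
have := sorted_ltn_nth (_ : transitive (relpre mdeg geq)) 0%MM s'_sorted.
move=> /(_ (fun _ _ _ le1 le2 => leq_trans le2 le1))/(_ j i).
rewrite !inE size_s' !ltn_ord lt_ji => /(_ isT isT isT) /=.
rewrite -[nth _ _ _]/(E i) -/(E j) -def_m2 def_m mdegD -[X in (_ <= X)%N]add0n
  leq_add2r leqn0.
rewrite mdeg_eq0 => /eqP m10; move: def_m; rewrite m10 add0m def_m2 => /eqP.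
by rewrite nth_uniq ?size_s' // gtn_eqF.
Qed.
End Quotient.
End FaceRingQuotient.

(** * Counting standard monomials *)

Section Counting.
Variables (r : nat) (Q : 'I_r -> nat) (k : nat).
Hypothesis Q_gt0 : forall i, (0 < Q i)%N.

(* Exponents of standard monomials are below [Q i * k], hence below [B]. *)
Let B := (\sum_i Q i * k)%N.

Definition box_monomial (a : {ffun 'I_r -> 'I_B}) : 'X_{1..r} :=
  [multinom (a i : nat) | i < r].

Definition count_on (F : {set 'I_r}) : nat :=
  #|[set a | (exp_support (box_monomial a) == F) &&
             (floor_weight Q (box_monomial a) < k)%N]|.

Lemma card_box_support (P : pred {set 'I_r}) :
  #|[set a | P (exp_support (box_monomial a)) &&
             (floor_weight Q (box_monomial a) < k)%N]|
  = (\sum_(F | P F) count_on F)%N.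
Proof.
rewrite -sum1dep_card (partition_big (fun a =>
  exp_support (box_monomial a)) P) /=; last first.
  by move=> a /andP[].
apply: eq_bigr => F PF; rewrite sum1dep_card; apply: eq_card => a; rewrite !inE.
by case: eqP => [->|]; rewrite ?PF ?andbT ?andbF.
Qed.

Lemma le_box i : (Q i * k <= B)%N.
Proof. by rewrite /B (bigD1 i) //= leq_addr. Qed.

Lemma standard_box (D : simplicial_complex r) :
  exists s, [/\ uniq s, forall m, (m \in s) = standard D Q k m
              & size s = (\sum_(F in faces D) count_on F)%N].
Proof.
exists [seq box_monomial a |
         a <- enum [set a | standard D Q k (box_monomial a)]].
split=> [|m|].
- rewrite map_inj_uniq ?enum_uniq // => a b /mnmP eq_ab; apply/ffunP => i.
  by apply/val_inj; have := eq_ab i; rewrite !mnmE.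
- apply/mapP/idP => [[a]|m_std]; first by rewrite mem_enum inE => std ->.
  have lt_mB i : (m i < B)%N.
    apply: leq_trans (le_box i); case/andP: m_std => _.
    rewrite /floor_weight (bigD1 i) //= => /(leq_ltn_trans (leq_addr _ _)).
    by rewrite ltn_divLR // mulnC.
  pose a : {ffun 'I_r -> 'I_B} := [ffun i => Ordinal (lt_mB i)].
  have def_m : m = box_monomial a by apply/mnmP => i; rewrite mnmE ffunE.
  by exists a; rewrite // mem_enum inE -def_m.
by rewrite size_map -cardE card_box_support.
Qed.

(** Functions vanishing outside [F] amount to tuples indexed by [F]; the
default value [ord0] of [nth] supplies the zeros outside [F]. *)
Lemma card_simplex_on (F : {set 'I_r}) n :
  #|[set c : {ffun 'I_r -> 'I_n.+1} |
      [forall i, (i \notin F) ==> (c i == ord0)] && (\sum_i c i <= n)%N]|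
  = 'C(#|F| + n, #|F|).
Proof.
rewrite -card_partial_ord_partitions.
pose g (t : #|F|.-tuple 'I_n.+1) := [ffun i => nth ord0 t (index i (enum F))].
have size_t (t : #|F|.-tuple 'I_n.+1) : size t = size (enum F).
  by rewrite size_tuple cardE.
have gK t : [seq g t i | i <- enum F] = t.
  apply: (@eq_from_nth _ ord0) => [|j]; rewrite size_map ?size_t // => lt_j.
  have x0 : 'I_r by case: (enum F) lt_j.
  by rewrite (nth_map x0) // ffunE index_uniq ?enum_uniq.
have sum_g t : (\sum_i g t i = \sum_(x <- t) x)%N.
  rewrite -[in RHS](gK t) big_map big_enum /= [RHS]big_mkcond;
    apply: eq_bigr => i _.
  case: ifPn => // inF.
  by rewrite ffunE nth_default // size_t memNindex ?mem_enum.
rewrite -(@card_imset _ _ g) => [|t1 t2 eq_g]; last first.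
  by apply/val_inj; rewrite /= -(gK t1) eq_g gK.
apply: eq_card => c; rewrite inE; apply/andP/imsetP => [[c0 le_c]|[t]].
  exists (map_tuple c (enum_tuple F)).
    rewrite inE big_map big_enum /= big_mkcond; apply: leq_trans le_c.
    by apply: leq_sum => i _; case: ifP.
  apply/ffunP => i; rewrite ffunE /=; have [iF|iF] := boolP (i \in F).
    by rewrite (nth_map i) ?nth_index ?index_mem ?mem_enum.
  rewrite nth_default ?size_map ?memNindex ?mem_enum //.
  exact/eqP/(implyP (forallP c0 i)).
rewrite inE => le_t ->; rewrite sum_g; split=> //; apply/forallP => i;
  apply/implyP => iF.
by rewrite ffunE nth_default // size_t memNindex ?mem_enum.
Qed.

Lemma card_div_eq n d c : (0 < d)%N -> (d * c.+1 <= n)%N ->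
  #|[pred x : 'I_n | (x %/ d == c)%N]| = d.
Proof.
move=> d_gt0 le_n.
have lt_in (j : 'I_d) : (c * d + j < n)%N.
  by apply: leq_trans le_n; rewrite mulnS addnC mulnC ltn_add2r.
pose g (j : 'I_d) := Ordinal (lt_in j).
rewrite -[RHS]card_ord -(@card_codom _ _ g) => [|j1 j2 [/addnI]];
  last exact: val_inj.
apply: eq_card => x; rewrite !inE; apply/eqP/codomP => [def_c|[j ->]] /=.
  exists (Ordinal (ltn_pmod x d_gt0)); apply/val_inj => /=.
  by rewrite -def_c -divn_eq.
by rewrite divnMDl // divn_small ?addn0.
Qed.

(** Group the monomials by the function of quotients [a i %/ Q i]: it ranges
over a lattice simplex, and over each of its points the remainders at the
indices in [F] are arbitrary. *)
Lemma sum_count_on (F : {set 'I_r}) : (0 < k)%N ->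
  (\sum_(G : {set 'I_r} | G \subset F) count_on G
   = (\prod_(i in F) Q i) * 'C(#|F| + k.-1, #|F|))%N.
Proof.
move=> k_gt0; rewrite -card_box_support -card_simplex_on.
have le_k x : (x <= k.-1)%N = (x < k)%N by rewrite -ltnS prednK.
pose C := [set c : {ffun 'I_r -> 'I_k.-1.+1} |
  [forall i, (i \notin F) ==> (c i == ord0)] && (\sum_i c i <= k.-1)%N].
pose p (a : {ffun 'I_r -> 'I_B}) : {ffun 'I_r -> 'I_k.-1.+1} :=
  [ffun i => inord (a i %/ Q i)].
have div_lt (a : {ffun 'I_r -> 'I_B}) i :
    (floor_weight Q (box_monomial a) < k)%N -> (a i %/ Q i < k.-1.+1)%N.
  by rewrite ltnS le_k; apply: leq_ltn_trans;
    rewrite /floor_weight (bigD1 i) //= mnmE leq_addr.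
have weight_p a : (floor_weight Q (box_monomial a) < k)%N ->
    floor_weight Q (box_monomial a) = (\sum_i p a i)%N.
  move=> a_lt; apply: eq_bigr => i _.
  by rewrite mnmE ffunE inordK ?div_lt.
rewrite -sum1dep_card (partition_big p (mem C)) /=; last first.
  move=> a /andP[/subsetP aF a_lt]; rewrite inE -weight_p // le_k a_lt andbT.
  apply/forallP => i; apply/implyP => iF; apply/eqP/val_inj;
    rewrite ffunE /= inordK ?div_lt //.
  by have := contra (aF i) iF; rewrite inE negbK mnmE => /eqP->; rewrite div0n.
rewrite -/C mulnC -sum_nat_const; apply: eq_bigr => c;
  rewrite inE => /andP[/forallP c0 le_c].
rewrite sum1dep_card.
pose fiber i := [pred x : 'I_B |
  (x %/ Q i == c i)%N && ((i \notin F) ==> (x == 0 :> nat)%N)].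
transitivity #|(family fiber : pred {ffun 'I_r -> 'I_B})|.
  apply: eq_card => a; rewrite inE; apply/idP/familyP => [|a_fib].
    case/andP=> /andP[/subsetP aF a_lt] /eqP p_a i;
      rewrite inE -p_a ffunE inordK ?div_lt // eqxx /=.
    apply/implyP => iF.
    by have := contra (aF i) iF; rewrite inE negbK mnmE.
  have a_div i : (a i %/ Q i = c i)%N by have := a_fib i;
    rewrite inE => /andP[/eqP].
  have a_lt : (floor_weight Q (box_monomial a) < k)%N.
    rewrite -le_k; apply: leq_trans le_c.
    by apply: leq_sum => i _; rewrite mnmE a_div.
  rewrite a_lt andbT; apply/andP; split; last first.
    by apply/eqP/ffunP => i; apply/val_inj;
      rewrite ffunE /= inordK ?div_lt ?a_div.
  apply/subsetP => i; rewrite inE mnmE; apply: contraR => iF.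
  by have := a_fib i; rewrite inE iF => /andP[].
rewrite card_family foldrE big_image /= [RHS]big_mkcond;
  apply: eq_bigr => i _ /=.
have [iF|iF] := boolP (i \in F).
  rewrite -[RHS](@card_div_eq B (Q i) (c i)) //; last first.
    by apply: leq_trans (le_box i); rewrite leq_pmul2l // -le_k -ltnS.
  by apply: eq_card => x; rewrite inE unfold_in /= andbT.
have B_gt0 : (0 < B)%N by apply: leq_trans (le_box i); rewrite muln_gt0 Q_gt0.
rewrite -(card1 (Ordinal B_gt0)); apply: eq_card => x; rewrite inE unfold_in /=.
have /eqP-> := implyP (c0 i) iF.
rewrite -[RHS]/(x == 0 :> nat)%N andbC; case: eqP => //= ->.
by rewrite div0n.
Qed.

End Counting.

(** * Polynomial functions of two positive integers *)

Definition poly_function (f : nat -> nat -> nat) : Prop :=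
  exists P : {mpoly rat[2]}, forall q k, (0 < q)%N -> (0 < k)%N ->
    (f q k)%:R = P.@[tnth [tuple q%:R; k%:R]].

Lemma poly_function_ext f g :
    (forall q k, (0 < q)%N -> (0 < k)%N -> f q k = g q k) ->
  poly_function f -> poly_function g.
Proof. by move=> fg [P fP]; exists P => q k q0 k0; rewrite -fg // fP. Qed.

Lemma poly_function_const c : poly_function (fun _ _ => c).
Proof. by exists (c%:R)%:MP => q k _ _; rewrite mevalC. Qed.

Lemma poly_function_fst : poly_function (fun q _ => q).
Proof. by exists 'X_0 => q k _ _; rewrite mevalXU. Qed.

Lemma poly_functionM f g :
  poly_function f -> poly_function g ->
  poly_function (fun q k => f q k * g q k)%N.
Proof.
by move=> [P fP] [P' gP]; exists (P * P') => q k q0 k0;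
  rewrite mevalM natrM fP ?gP.
Qed.

Lemma poly_function_sum (I : finType) (A : pred I)
    (f : I -> nat -> nat -> nat) :
    (forall i, A i -> poly_function (f i)) ->
  poly_function (fun q k => \sum_(i | A i) f i q k)%N.
Proof.
move=> fP; have /choice[P PP] i : exists P : {mpoly rat[2]}, A i ->
    forall q k, (0 < q)%N -> (0 < k)%N ->
    (f i q k)%:R = P.@[tnth [tuple q%:R; k%:R]].
  by have [/fP[P PP]|_] := boolP (A i); [exists P | exists 0].
exists (\sum_(i | A i) P i) => q k q0 k0.
by rewrite natr_sum raddf_sum; apply: eq_bigr => i /PP->.
Qed.

Lemma poly_function_prod (I : finType) (A : pred I)
    (f : I -> nat -> nat -> nat) :
    (forall i, A i -> poly_function (f i)) ->
  poly_function (fun q k => \prod_(i | A i) f i q k)%N.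
Proof.
move=> fP; have /choice[P PP] i : exists P : {mpoly rat[2]}, A i ->
    forall q k, (0 < q)%N -> (0 < k)%N ->
    (f i q k)%:R = P.@[tnth [tuple q%:R; k%:R]].
  by have [/fP[P PP]|_] := boolP (A i); [exists P | exists 0].
exists (\prod_(i | A i) P i) => q k q0 k0.
by rewrite natr_prod rmorph_prod; apply: eq_bigr => i /PP->.
Qed.

Lemma poly_function_addl f g :
  poly_function (fun q k => f q k + g q k)%N ->
  poly_function f -> poly_function g.
Proof.
move=> [S fgS] [P fP]; exists (S - P) => q k q0 k0.
by rewrite mevalB -fgS // -fP // natrD addrC addKr.
Qed.

(** The binomial is [(k + (n - 1)) ... (k + 1) k / n!], a polynomial in [k]
because [k] is positive. *)
Lemma poly_function_bin n : poly_function (fun _ k => 'C(n + k.-1, n)).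
Proof.
pose P : {mpoly rat[2]} := \prod_(j < n) ('X_1 + (n.-1 - j)%:R%:MP).
exists ((n`!%:R^-1)%:MP * P) => q k _ k_gt0.
rewrite mevalM mevalC rmorph_prod.
have fact_neq0 : n`!%:R != 0 :> rat by rewrite pnatr_eq0 -lt0n fact_gt0.
apply: (mulfI fact_neq0); rewrite mulVKf // mulrC -natrM bin_ffact ffact_prod
  natr_prod.
apply: eq_bigr => j _; rewrite /= mevalD mevalC mevalXU -natrD; congr _%:R.
have n_gt0 : (0 < n)%N by apply: leq_trans (ltn_ord j).
rewrite addnBA; last by rewrite -ltnS prednK.
by rewrite -[in RHS](prednK k_gt0) addSnnS prednK // addnC.
Qed.

(** The sum over all subsets of [F] is polynomial, and so are the terms of the
proper subsets by induction; subtract. *)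
Lemma poly_function_count_on r (v : 'I_r -> nat) (F : {set 'I_r}) :
  (forall i, 0 < v i)%N ->
  poly_function (fun q k => count_on (fun i => q * v i)%N k F).
Proof.
move=> v_gt0; have [n] := ubnP #|F|; elim: n F => // n IH F lt_F.
apply: (@poly_function_addl
  (fun q k => \sum_(G : {set 'I_r} | G \proper F)
                count_on (fun i => q * v i)%N k G)%N).
  apply: (@poly_function_ext
    (fun q k => (\prod_(i in F) (q * v i)) * 'C(#|F| + k.-1, #|F|))%N).
    move=> q k q_gt0 k_gt0; rewrite -sum_count_on // => [|i];
      last by rewrite muln_gt0 q_gt0 v_gt0.
    rewrite (bigD1 F) //= addnC; congr (_ + _)%N.
    by apply: eq_bigl => G; rewrite properEneq andbC.
  apply: poly_functionM (poly_function_bin _).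
  apply: poly_function_prod => i _.
  exact: poly_functionM poly_function_fst (poly_function_const _).
apply: poly_function_sum => G /proper_card lt_GF.
exact: IH (leq_trans lt_GF _).
Qed.

(** * The generalized Hilbert-Kunz function *)

Theorem theorem3p3 (K : fieldType) (r d : nat) (D : simplicial_complex r)
    (hd : krull_dim (face_ring K D) d)
    (v : 'I_r -> nat) (hv : forall i, (0 < v i)%N) :
  exists P : {mpoly rat[2]},
    forall q k : nat, (0 < q)%N -> (0 < k)%N ->
      exists2 n : nat,
        has_length (quotmod (ideal_exp (bracket_power K D v q) k)) n
        & n%:R = P.@[tnth [tuple q%:R; k%:R]].
Proof.
have [P PE] : poly_function (fun q k =>
    \sum_(F in faces D) count_on (fun i => q * v i)%N k F)%N.
  by apply: poly_function_sum => F _; apply: poly_function_count_on.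
exists P => q k q_gt0 k_gt0.
have Q_gt0 i : (0 < q * v i)%N by rewrite muln_gt0 q_gt0 hv.
have [s [s_uniq mem_s size_s]] := standard_box k Q_gt0 D.
exists (size s); last by rewrite -PE // size_s.
exact: (has_length_standard K Q_gt0 (fun=> erefl) s_uniq mem_s).
Qed.
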